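(* Let $\mathcal{G}=(\mathcal{V},\mathcal{E},w)$ be a strongly connected weighted directed graph with $N$ vertices, and let $\mathbf{P}$ be the transition matrix of the random walk on $\mathcal{G}$, assumed ergodic, with stationary distribution $\pi$. Let $\boldsymbol\xi\in\mathbb{C}^N$ be an eigenvector of $\mathbf{P}$ associated to the eigenvalue $\vartheta\in\mathbb{C}$, i.e. $\boldsymbol\xi\neq 0$ and $\mathbf{P}\boldsymbol\xi=\vartheta\boldsymbol\xi$. Then the Rayleigh quotient of $\boldsymbol\xi$ is given by $$\mathcal{R}_{\pi,\mathbf{P}}(\boldsymbol\xi)=1-\operatorname{Re}(\vartheta).$$
   Context: A weighted directed graph $\mathcal{G}=(\mathcal{V},\mathcal{E},w)$ has finite vertex set $\mathcal{V}=\{v_1,\dots,v_N\}$, directed edge set $\mathcal{E}\subseteq\mathcal{V}\times\mathcal{V}$, and weight function $w:\mathcal{V}\times\mathcal{V}\to[0,\infty)$ with $w(x,y)>0$ if $(x,y)\in\mathcal{E}$ and $w(x,y)=0$ otherwise. The random walk on $\mathcal{G}$ is the Markov chain on $\mathcal{V}$ with transition matrix $\mathbf{P}=(p(x,y))_{x,y\in\mathcal{V}}$, $p(x,y)=w(x,y)/\sum_{z}w(x,z)$; it acts on functions by $\mathbf{P}f(x)=\sum_y p(x,y)f(y)$. It is ergodic if it is irreducible and aperiodic; it then has a unique stationary distribution $\pi$ ($\sum_x\pi(x)p(x,y)=\pi(y)$, $\sum_x\pi(x)=1$), which is strictly positive. Functions $f:\mathcal{V}\to\mathbb{C}$ are identified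 with vectors $\boldsymbol f\in\mathbb{C}^N$. The space $\ell^2(\mathcal{V},\pi)$ has inner product $\langle \boldsymbol f,\boldsymbol g\rangle_\pi=\sum_{x\in\mathcal{V}}\overline{f(x)}g(x)\pi(x)$ and norm $\|\cdot\|_\pi$. With $\boldsymbol\Pi=\operatorname{diag}(\pi(v_1),\dots,\pi(v_N))$, the time-reversed transition matrix is $\mathbf{P}^*=\boldsymbol\Pi^{-1}\mathbf{P}^\top\boldsymbol\Pi$ (the adjoint of $\mathbf{P}$ in $\ell^2(\mathcal{V},\pi)$), and the random walk Laplacian is $\mathbf{L}_{\mathrm{RW}}=\mathbf{I}-\tfrac12(\mathbf{P}+\mathbf{P}^* )$. The Dirichlet energy of $\boldsymbol f$ is $$\mathcal{D}^2_{\pi,\mathbf{P}}(\boldsymbol f)=\frac12\sum_{(x,y)\in\mathcal{E}}\pi(x)p(x,y)|f(x)-f(y)|^2=\langle\boldsymbol f,\mathbf{L}_{\mathrm{RW}}\boldsymbol f\rangle_\pi,$$ and the Rayleigh quotient of $\boldsymbol f\neq0$ is $\mathcal{R}_{\pi,\mathbf{P}}(\boldsymbol f)=\mathcal{D}^2_{\pi,\mathbf{P}}(\boldsymbol f)/\|\boldsymbol f\|_\pi^2$. *)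

(* Defs.v *)
From HB Require Import structures.
From mathcomp Require Import all_boot all_order all_algebra.
From mathcomp Require Import complex.
From mathcomp Require Import reals.

Set Implicit Arguments.
Unset Strict Implicit.
Unset Printing Implicit Defensive.

Import Order.TTheory GRing.Theory Num.Theory.
Local Open Scope ring_scope.
Local Open Scope complex_scope.

(* Self-loops are allowed. Nonnegativity of the weight follows from the two
   axioms. *)
Record wdigraph (R : realType) (N : nat) := WDigraph {
  edge : rel 'I_N;
  weight : 'I_N -> 'I_N -> R;
  weight_gt0 : forall x y, edge x y -> 0 < weight x y;
  weight_eq0 : forall x y, ~~ edge x y -> weight x y = 0 }.

Definition strongly_connected (R : realType) (N : nat) (G : wdigraph R N) :=
  forall x y, connect (edge G) x y.

(* A row with zero total weight is sent to the zero row. *)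
Definition transition (R : realType) (N : nat) (G : wdigraph R N) : 'M[R]_N :=
  \matrix_(x, y) (weight G x y / \sum_z weight G x z).

Definition irreducible_mx (R : realType) (N : nat) (P : 'M[R]_N) :=
  forall x y, exists n, 0 < (P ^+ n) x y.

(* [d] is the greatest common divisor of the return times to [x]; it is [0]
   when [x] has no return time. *)
Definition is_period (R : realType) (N : nat) (P : 'M[R]_N) (x : 'I_N)
    (d : nat) :=
  (forall n, (0 < n)%N -> 0 < (P ^+ n) x x -> (d %| n)%N) /\
  (forall e, (forall n, (0 < n)%N -> 0 < (P ^+ n) x x -> (e %| n)%N) ->
     (e %| d)%N).

Definition aperiodic (R : realType) (N : nat) (P : 'M[R]_N) :=
  forall x, is_period P x 1.

Definition ergodic (R : realType) (N : nat) (P : 'M[R]_N) :=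
  irreducible_mx P /\ aperiodic P.

Definition stationary (R : realType) (N : nat) (P : 'M[R]_N) (pi : 'rV[R]_N) :=
  [/\ forall x, 0 <= pi 0 x, \sum_x pi 0 x = 1 & pi *m P = pi].

Definition dotpi (R : realType) (N : nat) (pi : 'rV[R]_N) (f g : 'cV[R[i]]_N) :
    R[i] :=
  \sum_x (f x 0)^* * g x 0 * (pi 0 x)%:C.

Definition normpi (R : realType) (N : nat) (pi : 'rV[R]_N) (f : 'cV[R[i]]_N) :
    R :=
  Num.sqrt (complex.Re (dotpi pi f f)).

(* [ComplexField.Normc.normc] is the real-valued modulus, whereas [`|z|] takes
   its values in [R[i]]. *)
Definition dirichlet (R : realType) (N : nat) (G : wdigraph R N)
    (pi : 'rV[R]_N) (f : 'cV[R[i]]_N) : R :=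
  2^-1 * \sum_x \sum_(y | edge G x y)
    pi 0 x * transition G x y * ComplexField.Normc.normc (f x 0 - f y 0) ^+ 2.

Definition rayleigh (R : realType) (N : nat) (G : wdigraph R N)
    (pi : 'rV[R]_N) (f : 'cV[R[i]]_N) : R :=
  dirichlet G pi f / normpi pi f ^+ 2.

(* Main.v *)
Require Import Defs.
From mathcomp Require Import all_boot all_order all_algebra.
From mathcomp Require Import complex.
From mathcomp Require Import reals.
From mathcomp Require Import ring.

Set Implicit Arguments.
Unset Strict Implicit.
Unset Printing Implicit Defensive.

Import Order.TTheory GRing.Theory Num.Theory.
Local Open Scope ring_scope.
Local Open Scope complex_scope.

(** Expand |xi x - xi y|^2 = |xi x|^2 + |xi y|^2 - 2 Re (conj (xi x) (xi y)) in
    the Dirichlet energy. The first two terms each sum to the squared norm of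
    xi, by the row sums of P and by stationarity; the cross term sums to
    Re theta times the squared norm, since P xi = theta xi. *)

Section NonnegativeMatrices.
Variables (R : realType) (N : nat).
Implicit Types (P : 'M[R]_N) (pi : 'rV[R]_N).

Lemma expmx_ge0 P n :
  (forall x y, 0 <= P x y) -> forall x y, 0 <= (P ^+ n) x y.
Proof.
move=> P_ge0; elim: n => [|n IHn] x y.
  by rewrite expr0 mxE; case: (x == y).
by rewrite exprS mxE sumr_ge0 // => z _; rewrite mulr_ge0.
Qed.

Lemma stationary_expmx P pi n : pi *m P = pi -> pi *m (P ^+ n) = pi.
Proof.
move=> piP; elim: n => [|n IHn]; first by rewrite expr0 mulmx1.
by rewrite exprS -[P * _]/(P *m _) mulmxA piP.
Qed.

(** Total mass 1 gives some [x] of positive mass, and irreducibility a power [n] with [(P ^+ n) x y]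
    positive. Since [pi] is also stationary for [P ^+ n], its value at [y] is at least the product
    of these two numbers. *)
Lemma stationary_gt0 P pi :
    (forall x y, 0 <= P x y) -> irreducible_mx P -> stationary P pi ->
  forall x, 0 < pi 0 x.
Proof.
move=> P_ge0 P_irr [pi_ge0 pi_sum1 piP] y.
have [x pix] : exists x, 0 < pi 0 x.
  apply/existsP; apply: contraT => /existsPn pi_le0.
  have /eqP := pi_sum1; rewrite big1 ?(eq_sym 0) ?oner_eq0 // => x _.
  by apply/eqP; rewrite eq_le pi_ge0 andbT leNgt pi_le0.
have [n Pxy] := P_irr x y.
rewrite -(stationary_expmx n piP) mxE (bigD1 x) //=.
apply: ltr_pwDl; first exact: mulr_gt0.
by apply: sumr_ge0 => z _; rewrite mulr_ge0 ?expmx_ge0.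
Qed.

(* [pi (1 - row sum)] is nonnegative and has total mass 0 by stationarity. *)
Lemma stationary_row_sum P pi :
    (forall x, \sum_y P x y <= 1) -> stationary P pi ->
  forall x, pi 0 x * \sum_y P x y = pi 0 x.
Proof.
move=> P_le1 [pi_ge0 pi_sum1 piP] x.
have defect_ge0 z : true -> 0 <= pi 0 z * (1 - \sum_y P z y).
  by move=> _; rewrite mulr_ge0 // subr_ge0.
have mass : \sum_z pi 0 z * (1 - \sum_y P z y) = 0.
  under eq_bigr => z _ do rewrite mulrBr mulr1 mulr_sumr.
  (* With the sums exchanged, the subtracted part is the total mass of [pi *m P]. *)
  rewrite sumrB [X in _ - X]exchange_big /=.
  apply/eqP; rewrite subr_eq0; apply/eqP/eq_bigr => y _.
  by rewrite -[in LHS]piP mxE.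
have /eqP := psumr_eq0P defect_ge0 mass (i:=x) isT.
by rewrite mulrBr mulr1 subr_eq0 => /eqP.
Qed.

End NonnegativeMatrices.

Section Transition.
Variables (R : realType) (N : nat) (G : wdigraph R N).

Lemma weight_ge0 x y : 0 <= weight G x y.
Proof.
by case: (boolP (edge G x y)) => [/weight_gt0/ltW|/weight_eq0 ->].
Qed.

Lemma transition_ge0 x y : 0 <= transition G x y.
Proof.
rewrite mxE divr_ge0 ?weight_ge0 // sumr_ge0 // => z _; exact: weight_ge0.
Qed.

(** A row sums to 1 unless its total weight is 0; in that case division by 0 makes it the zero row,
    hence an inequality. *)
Lemma transition_row_sum_le1 x : \sum_y transition G x y <= 1.
Proof.
under eq_bigr => y _ do rewrite mxE.
rewrite -mulr_suml; have [->|w_neq0] := eqVneq (\sum_z weight G x z) 0.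
  by rewrite mul0r.
by rewrite divff.
Qed.

Lemma transition_noedge x y : ~~ edge G x y -> transition G x y = 0.
Proof. by move=> /weight_eq0 w0; rewrite mxE w0 mul0r. Qed.

End Transition.

Section Complex.
Variable R : realType.
Implicit Types u v : R[i].

Lemma normc_sqr u :
  ComplexField.Normc.normc u ^+ 2 = complex.Re u ^+ 2 + complex.Im u ^+ 2.
Proof. by case: u => a b /=; rewrite sqr_sqrtr // addr_ge0 ?sqr_ge0. Qed.

Lemma normcB_sqr u v :
  ComplexField.Normc.normc (u - v) ^+ 2 =
    ComplexField.Normc.normc u ^+ 2 + ComplexField.Normc.normc v ^+ 2
    - 2 * complex.Re (u^* * v).
Proof. by rewrite !normc_sqr; case: u v => [a b] [c d] /=; ring. Qed.

Lemma Re_conjM u : complex.Re (u^* * u) = ComplexField.Normc.normc u ^+ 2.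
Proof. by rewrite normc_sqr; case: u => a b /=; ring. Qed.

Lemma Re_conjM_mul u v :
  complex.Re (u^* * (v * u)) =
    complex.Re v * ComplexField.Normc.normc u ^+ 2.
Proof. by rewrite normc_sqr; case: u v => [a b] [c d] /=; ring. Qed.

Lemma Re_mul_real u (a : R) : complex.Re (u * a%:C) = complex.Re u * a.
Proof. by case: u => b c /=; ring. Qed.

(** Nonnegativity of [pi] makes the sum under [Num.sqrt] nonnegative, so squaring cancels the
    root. *)
Lemma normpi_sqr N (pi : 'rV[R]_N) (f : 'cV[R[i]]_N) :
    (forall x, 0 <= pi 0 x) ->
  normpi pi f ^+ 2 =
    \sum_x pi 0 x * ComplexField.Normc.normc (f x 0) ^+ 2.
Proof.
move=> pi_ge0.
have dotE : complex.Re (dotpi pi f f) =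
    \sum_x pi 0 x * ComplexField.Normc.normc (f x 0) ^+ 2.
  rewrite raddf_sum; apply: eq_bigr => x _ /=.
  by rewrite Re_mul_real Re_conjM mulrC.
rewrite /normpi dotE sqr_sqrtr // sumr_ge0 // => x _.
by rewrite mulr_ge0 ?sqr_ge0.
Qed.

End Complex.

Theorem proposition6p1 (R : realType) (N : nat) (G : wdigraph R N)
    (pi : 'rV[R]_N) (xi : 'cV[R[i]]_N) (theta : R[i])
    (Gconn : strongly_connected G)
    (Perg : ergodic (transition G))
    (pi_stat : stationary (transition G) pi)
    (xi_neq0 : xi != 0)
    (xi_eigen :
       map_mx (real_complex R) (transition G) *m xi = theta *: xi) :
  rayleigh G pi xi = 1 - complex.Re theta.
Proof.
have [P_irr _] := Perg.
have pi_gt0 := stationary_gt0 (transition_ge0 G) P_irr pi_stat.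
have pi_row := stationary_row_sum (transition_row_sum_le1 G) pi_stat.
have [pi_ge0 _ piP] := pi_stat.
pose P := transition G; pose n2 x := ComplexField.Normc.normc (xi x 0) ^+ 2.
pose S := \sum_x pi 0 x * n2 x.
(* [S] is the squared norm of [xi], to be cancelled in the quotient. If it vanished, so would each
   of its nonnegative terms, and strict positivity of [pi] would force [xi] to be 0. *)
have S_neq0 : S != 0.
  apply: contra xi_neq0 => /eqP S0; apply/eqP/colP => x; rewrite mxE.
  have term_ge0 z : true -> 0 <= pi 0 z * n2 z.
    by rewrite mulr_ge0 ?sqr_ge0.
  have /eqP := psumr_eq0P term_ge0 S0 (i:=x) isT.
  rewrite mulf_eq0 (gt_eqF (pi_gt0 x)) /= expf_eq0 /= => /eqP.
  exact: ComplexField.Normc.eq0_normc.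
(* The weight [pi 0 x] lets [pi_row] stand in for a row sum equal to 1. *)
have out_sum : \sum_x \sum_y pi 0 x * P x y * n2 x = S.
  by apply: eq_bigr => x _; rewrite -mulr_suml -mulr_sumr pi_row.
have in_sum : \sum_x \sum_y pi 0 x * P x y * n2 y = S.
  rewrite exchange_big; apply: eq_bigr => y _ /=.
  by rewrite -mulr_suml -[in RHS]piP mxE.
have cross_sum :
    \sum_x \sum_y pi 0 x * P x y * complex.Re ((xi x 0)^* * xi y 0) =
    complex.Re theta * S.
  rewrite mulr_sumr; apply: eq_bigr => x _.
  have /colP/(_ x) := xi_eigen; rewrite !mxE => eigen_x.
  (* The factor [theta * xi x 0] is traded for the sum of [P x y * xi y 0] over [y]; the entries of
     [P] are real, so they come out of the real part. *)
  rewrite mulrCA -Re_conjM_mul -eigen_x mulr_sumr raddf_sum mulr_sumr.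
  apply: eq_bigr => y _ /=; rewrite -mulrA; congr (_ * _).
  by rewrite [map_mx _ _ _ _]mxE mulrCA [in RHS]mulrC Re_mul_real mulrC.
have energy : dirichlet G pi xi = (1 - complex.Re theta) * S.
  have -> : dirichlet G pi xi =
      2^-1 * \sum_x \sum_y (pi 0 x * P x y * n2 x + pi 0 x * P x y * n2 y
        - 2 * (pi 0 x * P x y * complex.Re ((xi x 0)^* * xi y 0))).
    (* The energy runs over edges only; as [P] vanishes off the edges, the sum extends to all pairs,
       where the row and column sums apply. *)
    congr (_ * _); apply: eq_bigr => x _; rewrite big_mkcond.
    apply: eq_bigr => y _; case: ifPn => [_|/transition_noedge P0].
      by rewrite normcB_sqr /n2; ring.
    by rewrite /P P0; ring.
  under eq_bigr => x _ do rewrite sumrB big_split /= -mulr_sumr.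
  rewrite sumrB big_split /= -mulr_sumr out_sum in_sum cross_sum.
  by field.
by rewrite /rayleigh normpi_sqr // energy mulfK.
Qed.
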